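(* Let $L$ be a loop with Central-holomorph $H(L)$. Then $L$ is an A-SAL if and only if $H(L)$ is an A-SAL.
   Context: Mappings are written on the right, so $\alpha\beta$ means first $\alpha$, then $\beta$. For a loop $(L,\cdot)$ let $Aum(L,\cdot)$ be its automorphism group. The holomorph $H(L)=(H,\circ)$ is the loop on the set $H$ of pairs $(\alpha,x)$ with $\alpha\in Aum(L,\cdot)$, $x\in L$, with operation $(\alpha,x)\circ(\beta,y)=(\alpha\beta,\ x\beta\cdot y)$. The symbol $x^{-1}$ denotes the two-sided inverse of $x$ (assumed to exist in $L$). The nucleus $N(L)$ is the set of $a\in L$ with $a\cdot xy=ax\cdot y$, $x\cdot ay=xa\cdot y$, $x\cdot ya=xy\cdot a$ for all $x,y\in L$; the centrum $C(L)$ is the set of $a\in L$ with $ax=xa$ for all $x\in L$; the center is $Z(L)=N(L)\cap C(L)$. $H(L)$ is called a Central-holomorph of $L$ if $x^{-1}\cdot x\alpha\in Z(L)$ or $x\alpha\cdot x^{-1}\in Z(L)$ for all $x\in L$ and $\alpha\in Aum(L,\cdot)$. An A-loop is a loop all of whose inner mappings (the elements of the multiplication group, generated by all left and right translations, that fix the identity element) are automorphisms. A loop is a Smarandache A-loop (SAL) if it has at least one non-trivial subloop that is an A-loop. An A-SAL is a loop that is both an A-loop and a SAL. *)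

(* Defs.v *)
From HB Require Import structures.
From mathcomp Require Import all_boot.
From mathcomp Require Import boolp.

Set Implicit Arguments.
Unset Strict Implicit.
Unset Printing Implicit Defensive.

Local Open Scope group_scope.

(* Mappings are written on the left here: the paper's x\alpha is [a x], and   *)
(* its composite \alpha\beta (first \alpha, then \beta) is [b \o a].          *)

HB.mixin Record UMagma_isLoop G of UMagma G := {
  mulg_bijl : forall a : G, bijective (fun x : G => a * x);
  mulg_bijr : forall a : G, bijective (fun x : G => x * a)
}.

#[short(type="loopType")]
HB.structure Definition Loop := {G of UMagma_isLoop G & UMagma G}.

(* [loop_inv x] is only a two-sided inverse of x; the inverse property        *)
(* loop_inv x * (x * y) = y is not required.                                  *)
HB.mixin Record Loop_hasTwoSidedInv G of Loop G := {
  loop_inv : G -> G;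
  loop_mulVg : left_inverse 1 loop_inv (@mul G);
  loop_mulgV : right_inverse 1 loop_inv (@mul G)
}.

#[short(type="twoSidedInvLoopType")]
HB.structure Definition TwoSidedInvLoop := {G of Loop_hasTwoSidedInv G & Loop G}.

(* A subset S of G together with a copy of it that is a loop under the        *)
(* operation of G.                                                            *)
#[short(type="subLoopType")]
HB.structure Definition SubLoop (G : loopType) (S : pred G) :=
  {H of SubUMagma G S H & Loop H}.

Definition is_automorphism (L : loopType) (f : L -> L) : Prop :=
  bijective f /\ {morph f : x y / x * y}.

Record Aum (L : loopType) := MkAum {
  aum_fun :> L -> L;
  aumP : is_automorphism aum_fun
}.

HB.instance Definition _ (L : loopType) := gen_eqMixin (Aum L).
HB.instance Definition _ (L : loopType) := gen_choiceMixin (Aum L).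

Section AumGroup.
Variable L : loopType.
Implicit Types a b c : Aum L.

Lemma aum_ext a b : a =1 b -> a = b.
Proof.
case: a b => [f fP] [g gP] /= /funext fg; case: _ / fg in gP *.
by congr MkAum; exact: Prop_irrelevance.
Qed.

Lemma aumM a : {morph a : x y / x * y}. Proof. by case: (aumP a). Qed.

Lemma aum_bij a : bijective a. Proof. by case: (aumP a). Qed.

Lemma aum1 a : a 1 = 1.
Proof. by apply: (bij_inj (mulg_bijl (a 1))); rewrite -aumM !mulg1. Qed.

Lemma id_is_aum : is_automorphism (@id L).
Proof. by split=> //; exists id. Qed.

Lemma comp_is_aum a b : is_automorphism (b \o a).
Proof.
by split=> [|x y /=]; [exact: bij_comp (aum_bij b) (aum_bij a) | rewrite !aumM].
Qed.

Lemma aum_inv_ex a :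
  exists g : L -> L, [/\ is_automorphism g, cancel a g & cancel g a].
Proof.
have [g ag ga] := aum_bij a; exists g; split=> //; split; first by exists a.
by move=> x y; apply: (can_inj ag); rewrite aumM !ga.
Qed.

Definition aum_one : Aum L := MkAum id_is_aum.
Definition aum_mul a b : Aum L := MkAum (comp_is_aum a b).
Definition aum_inv a : Aum L :=
  let: exist g gP := cid (aum_inv_ex a) in let: And3 gaut _ _ := gP in MkAum gaut.

Lemma aum_invK a : cancel a (aum_inv a) /\ cancel (aum_inv a) a.
Proof. by rewrite /aum_inv; case: (cid _) => g []. Qed.

Lemma aum_mulA : associative aum_mul.
Proof. by move=> a b c; exact: aum_ext. Qed.

Lemma aum_mul1 : left_id aum_one aum_mul.
Proof. by move=> a; exact: aum_ext. Qed.

Lemma aum_1mul : right_id aum_one aum_mul.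
Proof. by move=> a; exact: aum_ext. Qed.

Lemma aum_mulV : left_inverse aum_one aum_inv aum_mul.
Proof. by move=> a; apply: aum_ext; exact: (aum_invK a).2. Qed.

Lemma aum_Vmul : right_inverse aum_one aum_inv aum_mul.
Proof. by move=> a; apply: aum_ext; exact: (aum_invK a).1. Qed.

HB.instance Definition _ :=
  isGroup.Build (Aum L) aum_mulA aum_mul1 aum_1mul aum_mulV aum_Vmul.

Lemma aumE a b x : (a * b) x = b (a x). Proof. by []. Qed.

End AumGroup.

(* A separate type name, since Aum L * L already carries the direct product.  *)
Definition holomorph (L : loopType) : Type := (Aum L * L)%type.

HB.instance Definition _ (L : loopType) :=
  Choice.copy (holomorph L) (Aum L * L)%type.

Section Holomorph.
Variable L : loopType.

Definition hol_mul (u v : holomorph L) : holomorph L :=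
  (u.1 * v.1, v.1 u.2 * v.2).

Definition hol_one : holomorph L := (1, 1).

HB.instance Definition _ := hasMul.Build (holomorph L) hol_mul.

Lemma hol_mul1 : left_id hol_one (@mul (holomorph L)).
Proof. by case=> a x; congr (_, _) => /=; rewrite ?mul1g ?aum1 ?mul1g. Qed.

Lemma hol_1mul : right_id hol_one (@mul (holomorph L)).
Proof. by case=> a x; congr (_, _) => /=; rewrite mulg1. Qed.

HB.instance Definition _ :=
  Magma_isUMagma.Build (holomorph L) hol_mul1 hol_1mul.

Lemma hol_bijl (u : holomorph L) : bijective (fun v : holomorph L => u * v).
Proof.
have dP c : {g | cancel (fun x : L => c * x) g & cancel g (fun x => c * x)}.
  by apply: cid2; case: (mulg_bijl c) => g; exists g.
case: u => a x.
exists (fun w : holomorph L =>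
  ((a^-1 * w.1, (let: exist2 g _ _ := dP ((a^-1 * w.1) x) in g) w.2))
  : holomorph L).
- move=> [b y]; congr (_, _); rewrite /= ?mulKg //.
  have -> : b (a (a^-1 x)) = b x by rewrite (aum_invK a).2.
  by case: (dP _) => g + _; apply.
- move=> [b y]; congr (_, _); rewrite /= ?mulVKg //.
  by case: (dP _) => g _; apply.
Qed.

Lemma hol_bijr (u : holomorph L) : bijective (fun v : holomorph L => v * u).
Proof.
case: u => b y; have [g yg gy] := mulg_bijr y.
exists (fun w : holomorph L => (w.1 * b^-1, (b^-1 : Aum L) (g w.2))
  : holomorph L).
- move=> [a x]; congr (_, _); rewrite /= ?mulgK //.
  by rewrite [g _]yg -aumE mulgV.
- move=> [a x]; congr (_, _); rewrite /= ?mulgVK //.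
  by rewrite -aumE mulVg [LHS]gy.
Qed.

HB.instance Definition _ := UMagma_isLoop.Build (holomorph L) hol_bijl hol_bijr.

End Holomorph.

Definition nucleus (L : loopType) (a : L) : Prop :=
  forall x y : L,
    [/\ a * (x * y) = (a * x) * y,
        x * (a * y) = (x * a) * y
      & x * (y * a) = (x * y) * a].

Definition centrum (L : loopType) (a : L) : Prop :=
  forall x : L, commute a x.

Definition loop_center (L : loopType) (a : L) : Prop :=
  nucleus a /\ centrum a.

Definition has_central_holomorph (L : twoSidedInvLoopType) : Prop :=
  forall (x : L) (a : Aum L),
    loop_center (loop_inv x * a x) \/ loop_center (a x * loop_inv x).

Inductive mult_group (L : loopType) : (L -> L) -> Prop :=
| mult_group_l (a : L) : mult_group (fun x => a * x)
| mult_group_r (a : L) : mult_group (fun x => x * a)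
| mult_group_id : mult_group id
| mult_group_comp (f g : L -> L) :
    mult_group f -> mult_group g -> mult_group (g \o f)
| mult_group_inv (f g : L -> L) :
    mult_group f -> cancel f g -> cancel g f -> mult_group g.

Definition inner_mapping (L : loopType) (f : L -> L) : Prop :=
  mult_group f /\ f 1 = 1.

Definition A_loop (L : loopType) : Prop :=
  forall f : L -> L, inner_mapping f -> is_automorphism f.

(* Non-trivial means different from {1}; the subloop need not be proper. The  *)
(* proper reading would falsify the holomorph theorem: for L cyclic of order  *)
(* 3 every automorphism satisfies the centrality condition, H(L) is S_3,      *)
(* which has a proper non-trivial subgroup, whereas L has none.               *)
Definition Smarandache_A_loop (L : loopType) : Prop :=
  exists (S : pred L) (K : subLoopType S),
    (exists x : L, S x /\ x != 1) /\ A_loop K.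

Definition A_SAL (L : loopType) : Prop := A_loop L /\ Smarandache_A_loop L.

(* Main.v *)
From HB Require Import structures.
Require Import Defs.
From mathcomp Require Import all_boot.
From mathcomp Require Import boolp.

(** A non-trivial A-loop is a non-trivial A-subloop of itself, so being an
    A-SAL amounts to being a non-trivial A-loop ([A_SALP]).  A loop and its
    holomorph are trivial together ([holomorph_nontrivial]), and it remains to
    compare the A-loop properties of [L] and of [holomorph L].

    The inner mappings are made accessible by [A_loopP]: a loop is an A-loop as
    soon as the two families T_p, defined by x p = p T_p(x), and l_(p,q),
    defined by p (q x) = (p q) l_(p,q)(x), consist of automorphisms.  In a form
    free of inverses, these are implications between equations of the loop.
    Since x |-> (1, x) embeds [L] in [holomorph L], the implications for the
    holomorph contain those for [L] ([A_loop_of_holomorph]).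

    For the other direction, centrality of the holomorph says that every
    automorphism moves every x to x k with k in the center
    ([central_holomorph_automorphisms]).  A central factor in p or q changes
    neither T_p nor l_(p,q), so these maps are the same for p, q and for their
    images under automorphisms ([aum_commuted], [aum_associated]); in other
    words they commute with all automorphisms.  Now the L-component of a product
    in the holomorph is a product in [L] whose factors are twisted by
    automorphisms, and this insensitivity lets the twists be moved freely until
    the implication for [L] applies ([holomorph_A_loop]). *)

Set Implicit Arguments.
Unset Strict Implicit.
Unset Printing Implicit Defensive.

Local Open Scope group_scope.

(** For bijective [F] this says that the left translation by [p] turns [F] into
    an automorphism: [F x = p * phi x] with [phi] multiplicative. *)
Definition translated_morph (L : loopType) (p : L) (F : L -> L) : Prop :=
  forall x y x' y', F x = p * x' -> F y = p * y' -> F (x * y) = p * (x' * y').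

Section TranslatedAutomorphisms.
Variable L : loopType.

Lemma translated_morphP (p : L) (F : L -> L) :
  bijective F -> translated_morph p F ->
  exists phi : Aum L, forall x, F x = p * phi x.
Proof.
move=> bijF trF; have [d pd dp] := mulg_bijl p.
have FE x : F x = p * d (F x) by rewrite dp.
suff dF_aut : is_automorphism (d \o F) by exists (MkAum dF_aut).
split=> [|x y /=]; first by apply: bij_comp bijF; exists (fun x => p * x).
by apply: (can_inj pd); rewrite -FE; exact: trF.
Qed.

(** Undoing the left translation by [F 1] makes [F] an inner mapping. *)
Lemma A_loop_translated_morph (F : L -> L) :
  A_loop L -> mult_group F -> translated_morph (F 1) F.
Proof.
move=> AL mF x y x' y' Fx Fy; have [d pd dp] := mulg_bijl (F 1).
have inner_dF : inner_mapping (d \o F).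
  split; last by have /= := pd 1; rewrite mulg1.
  by apply: mult_group_comp => //; apply: mult_group_inv pd dp; exact: mult_group_l.
have [_ dFM] := AL _ inner_dF.
have dF u u' : F u = F 1 * u' -> (d \o F) u = u' by move=> /= ->.
by rewrite -(dF _ _ Fx) -(dF _ _ Fy) -dFM /= dp.
Qed.

(** When the maps T_p and l_(p,q) are automorphisms, the left translations of
    automorphisms contain all translations and are closed under composition and
    inverse; they therefore exhaust the multiplication group, and such a map
    fixes 1 only if it is the automorphism itself.  Two of the usual three
    families of inner mappings suffice because the right translation by [p] is
    the left one composed with T_p. *)
Lemma A_loopP :
  A_loop L <->
    (forall p : L, translated_morph p (fun x => x * p)) /\
    (forall p q : L, translated_morph (p * q) (fun x => p * (q * x))).
Proof.
split=> [AL|[trR trL]].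
  split=> [p|p q].
    by have := A_loop_translated_morph AL (mult_group_r p); rewrite mul1g.
  have := A_loop_translated_morph AL
    (mult_group_comp (mult_group_l q) (mult_group_l p)).
  by rewrite /= mulg1.
have leftP p q : exists l : Aum L, forall x, p * (q * x) = p * q * l x.
  apply: translated_morphP (trL p q).
  exact: bij_comp (mulg_bijl p) (mulg_bijl q).
have splitP F : mult_group F ->
    exists p : L, exists phi : Aum L, forall x, F x = p * phi x.
  elim=> {F} [a|a||f g _ [p [phi fE]] _ [q [psi gE]]|f g _ [p [phi fE]] fg gf].
  - by exists a, 1.
  - by exists a; exact: translated_morphP (mulg_bijr a) (trR a).
  - by exists 1, 1 => x; rewrite mul1g.
  - have [l lE] := leftP q (psi p); exists (q * psi p), (phi * psi * l) => x.
    by rewrite /= fE gE aumM lE.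
  (* Here d 1 is the right inverse of p, so p * (d 1 * x) = l x and the *)
  (* inverse of the translation x |-> p * x is x |-> d 1 * l^-1 x.      *)
  - have [d _ dp] := mulg_bijl p; have [l lE] := leftP p (d 1).
    exists ((phi^-1 : Aum L) (d 1)), (l^-1 * phi^-1) => y.
    apply: (can_inj fg); rewrite gf fE aumM.
    by rewrite aumE !(aum_invK phi).2 lE dp mul1g (aum_invK l).2.
move=> F [/splitP[p [phi FE]]]; rewrite FE aum1 mulg1 => p1.
by rewrite (_ : F = phi); [exact: aumP | apply/funext=> x; rewrite FE p1 mul1g].
Qed.

End TranslatedAutomorphisms.

Section WholeLoop.
Variable G : loopType.

(** A second name for the carrier of [G], to be registered as the subloop of [G]
    with full carrier. *)
Definition whole_loop : Type := G.

HB.instance Definition _ := Loop.copy whole_loop G.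

Definition whole_val (x : whole_loop) : G := x.
Definition Whole (x : G) (_ : predT x) : whole_loop := x.

Lemma whole_rect (P : whole_loop -> Type) :
  (forall x (Tx : predT x), P (Whole Tx)) -> forall u, P u.
Proof. by move=> PW u; exact: PW (erefl : predT u). Qed.

HB.instance Definition _ :=
  @isSub.Build G predT whole_loop whole_val Whole whole_rect (fun _ _ => erefl).
HB.instance Definition _ :=
  @isSubMagma.Build G predT whole_loop (fun _ _ => erefl).
HB.instance Definition _ :=
  @isSubBaseUMagma.Build G predT whole_loop erefl.

Lemma A_SALP : A_SAL G <-> A_loop G /\ exists x : G, x != 1.
Proof.
split=> [[AG [S [K [[x [_ x1]] _]]]]|[AG [x x1]]]; first by split=> //; exists x.
split=> //; exists predT, whole_loop; split; first by exists x.
(* The loop structures of whole_loop and G are not convertible, only their *)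
(* operations are; the criterion mentions nothing but the operation.       *)
by apply/A_loopP; move/A_loopP: AG.
Qed.

End WholeLoop.

Section Center.
Variable L : loopType.
Implicit Types (a : Aum L) (p q x y w k m : L).

Lemma aum_center a k : loop_center k -> loop_center (a k).
Proof.
have [g _ ga] := aum_bij a.
move=> [Nk Ck]; split=> [x y|x].
  have [k1 k2 k3] := Nk (g x) (g y).
  by split; rewrite -[x]ga -[y]ga -!aumM ?k1 ?k2 ?k3.
by rewrite /commute -[x]ga -!aumM Ck.
Qed.

Lemma center_mulACA p q k m :
  loop_center k -> loop_center m -> (p * k) * (q * m) = (p * q) * (k * m).
Proof.
move=> [Nk Ck] [Nm Cm].
have [_ _ ->] := Nm (p * k) q; have [_ <- _] := Nk p q.
have [_ _ ->] := Nm (p * q) k; have [_ _ <-] := Nk p q.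
by rewrite Ck.
Qed.

Lemma center_slide x q k m :
  loop_center k -> loop_center m -> x * (q * (k * m)) = (x * m * k) * q.
Proof.
move=> [Nk Ck] [Nm Cm].
have [_ _ ->] := Nm q k; rewrite -Cm; have [_ -> _] := Nm x (q * k).
by rewrite -Ck; have [_ -> _] := Nk (x * m) q.
Qed.

(** T_x depends on [x] only modulo the center. *)
Lemma center_commuted_by_mul k x w w' :
  loop_center k -> w * x = x * w' -> w * (x * k) = (x * k) * w'.
Proof.
move=> [Nk Ck] E; have [_ _ ->] := Nk w x; have [_ <- _] := Nk x w'.
by rewrite E Ck; have [_ _ ->] := Nk x w'.
Qed.

(** l_(x,y) depends on [x] and [y] only modulo the center. *)
Lemma center_associated_mul k m x y w w' :
  loop_center k -> loop_center m ->
  x * (y * w) = (x * y) * w' ->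
  (x * k) * ((y * m) * w) = ((x * k) * (y * m)) * w'.
Proof.
move=> Zk Zm E; have [[_ Ck] [Nm Cm]] := (Zk, Zm).
have [_ <- _] := Nm y w; rewrite Cm; have [_ _ ->] := Nm y w.
rewrite [LHS]center_mulACA // E [in RHS]center_mulACA // -center_mulACA // -Cm.
by have [_ -> _] := Nm (x * y * k) w'; have [_ _ <-] := Nm (x * y) k.
Qed.

End Center.

Definition central_automorphisms (L : loopType) : Prop :=
  forall (a : Aum L) (x : L), exists2 k, loop_center k & a x = x * k.

(** Although the inverse property is not available, a central [k] equal to
    x^-1 * a x or to a x * x^-1 can be moved past x^-1, so that cancelling x^-1
    alone yields a x = x * k. *)
Lemma central_holomorph_automorphisms (L : twoSidedInvLoopType) :
  has_central_holomorph L -> central_automorphisms L.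
Proof.
move=> hL a x; case: (hL x a) => Zz; eexists; try exact: Zz; have [Nz Cz] := Zz.
  apply: (bij_inj (mulg_bijl (loop_inv x))).
  by have [_ _ ->] := Nz (loop_inv x) x; rewrite loop_mulVg mul1g.
apply: (bij_inj (mulg_bijr (loop_inv x))).
by rewrite -Cz; have [<- _ _] := Nz x (loop_inv x); rewrite loop_mulgV mulg1.
Qed.

Section Holomorph.
Variable L : loopType.

Lemma holomorph_eqP (u v : holomorph L) : u = v <-> u.1 = v.1 /\ u.2 = v.2.
Proof. by case: u v => [a x] [b y] /=; split=> [[]|[-> ->]]. Qed.

(** If [L] is trivial then so is its automorphism group. *)
Lemma holomorph_nontrivial :
  (exists u : holomorph L, u != 1) <-> (exists x : L, x != 1).
Proof.
split=> [[u]|[x x1]]; last first.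
  by exists (1, x); apply: contra_neq x1 => /holomorph_eqP[].
apply: contraPP => L1; apply/negP; rewrite negbK; apply/eqP/holomorph_eqP.
have {}L1 x : x = 1 :> L by apply: contrapT => /eqP x1; apply: L1; exists x.
by split=> /=; [apply: aum_ext => x |]; rewrite [LHS]L1 // [RHS]L1.
Qed.

Lemma A_loop_of_holomorph : A_loop (holomorph L) -> A_loop L.
Proof.
move=> /A_loopP[trR trL]; apply/A_loopP.
pose i x : holomorph L := (1, x).
have iM x y : i x * i y = i (x * y) by congr (_, _); rewrite /= mulg1.
have i_inj x y : i x = i y -> x = y by case.
split=> [p|p q] x y x' y' Ex Ey; apply: i_inj; rewrite -!iM.
  by apply: trR; rewrite !iM ?Ex ?Ey.
have := trL (i p) (i q) (i x) (i y) (i x') (i y').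
by rewrite !iM Ex Ey => ->.
Qed.

Hypothesis centralL : central_automorphisms L.

Lemma aum_commuted (a : Aum L) x w w' : w * x = x * w' -> w * a x = a x * w'.
Proof. by have [k Zk ->] := centralL a x; exact: center_commuted_by_mul. Qed.

Lemma aum_associated (a : Aum L) x y w w' :
  x * (y * w) = (x * y) * w' -> a x * (a y * w) = (a x * a y) * w'.
Proof.
have [k Zk ->] := centralL a x; have [m Zm ->] := centralL a y.
exact: center_associated_mul.
Qed.

(** For T_u with u = (a, x), the automorphism components give c' = a^-1 c a, and
    (c, z) is sent to (c', z') with x (k z') = a z x, where c' x = x k: a map of
    the form z |-> T_x (a z), corrected by the central factor k.  It is
    multiplicative because k obeys the cocycle rule
    (c' d') x = x (m (d' k)), with d' x = x m.  The map l_(u,v) leaves the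
    automorphism component unchanged and acts on [L] by some l_(p,q), which
    commutes with automorphisms. *)
Lemma holomorph_A_loop : A_loop L -> A_loop (holomorph L).
Proof.
move=> /A_loopP[trR trL]; apply/A_loopP; split.
  move=> [a x] [c z] [d t] [c' z'] [d' t'].
  move=> /holomorph_eqP[/= ca Ez] /holomorph_eqP[/= da Et].
  apply/holomorph_eqP; split=> /=; first by rewrite -mulgA da !mulgA ca.
  have [k Zk xk] := centralL c' x; have [m Zm xm] := centralL d' x.
  have {}Et : a t * x = x * (m * t').
    by rewrite Et xm; have [[Nm _] _] := (Zm, Zk); have [_ <- _] := Nm x t'.
  have {}Ez : a (d z) * x = x * d' (k * z').
    have -> : a (d z) = d' (a z) by rewrite -!aumE da.
    have {}Ez : d' (a z) * d' x = d' x * d' (k * z').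
      rewrite -!aumM Ez xk; have [[Nk _] _] := (Zk, Zm).
      by have [_ <- _] := Nk x z'.
    (* The images under d' multiply d' x on both sides; applying d'^-1 to *)
    (* this one factor brings back x.                                     *)
    by have := aum_commuted d'^-1 Ez; rewrite (aum_invK d').1.
  rewrite aumM (trR _ _ _ _ _ Ez Et) xk !aumM xm.
  have Zdk := aum_center d' Zk; rewrite -center_slide //; congr (_ * _).
  have [[_ Cdk] [_ Cm]] := (Zdk, Zm).
  by rewrite Cdk Cm center_mulACA.
move=> [a x] [b y] [c z] [d t] [c' z'] [d' t'].
move=> /holomorph_eqP[/= cc' Ez] /holomorph_eqP[/= dd' Et].
have {}cc' : c = c' by apply: (mulgI (a * b)); rewrite -mulgA.
have {}dd' : d = d' by apply: (mulgI (a * b)); rewrite -mulgA.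
rewrite -{}cc' -{}dd' in Ez Et *.
apply/holomorph_eqP; split=> /=; first by rewrite !mulgA.
(* Ez is transported by d; in Et, which involves d (b x) and d y, the *)
(* automorphism d^-1 * c * d replaces these by d (c (b x)), d (c y).  *)
have cdE u : (d^-1 * c * d) (d u) = d (c u) by rewrite !aumE (aum_invK d).1.
rewrite !aumM; apply: trL.
  by rewrite -!aumM Ez !aumM.
by rewrite -!cdE; apply: aum_associated; rewrite Et aumM.
Qed.

End Holomorph.

Theorem theorem3p16 (L : twoSidedInvLoopType) (hL : has_central_holomorph L) :
  A_SAL L <-> A_SAL (holomorph L).
Proof.
have centralL := central_holomorph_automorphisms hL.
rewrite !A_SALP holomorph_nontrivial; split=> -[AL nontrivL]; split=> //.
  exact: holomorph_A_loop.
exact: A_loop_of_holomorph.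
Qed.
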